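(* Let $k$ be a positive integer. For integers $q\ge 2$ let \[ G_k(q) = \min \{ |kA| : A\subset \mathbb{Z} \text{ finite},\ A-A \supset \{a+1, \ldots, a+q \} \text{ for some integer } a \}, \] and put $\alpha_k = \inf_{q\geq 2} \frac{\log G_k(q)}{\log q}$. Then \[ 1-2^{-k} \leq \alpha_k < 1 . \]
   Context: For a set $A$ of integers, $kA = A+\cdots+A$ ($k$ times) is the set of all sums of $k$ (not necessarily distinct) elements of $A$, and $A-A=\{a-b: a,b\in A\}$. *)

(* Defs.v *)
From HB Require Import structures.
From mathcomp Require Import all_boot all_order all_algebra.
From mathcomp Require Import finmap.
From mathcomp Require Import all_classical all_reals all_analysis.

Set Implicit Arguments.
Unset Strict Implicit.
Unset Printing Implicit Defensive.

Import Order.TTheory GRing.Theory Num.Theory.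

Local Open Scope fset_scope.
Local Open Scope classical_set_scope.
Local Open Scope ring_scope.

Definition sumset (A B : {fset int}) : {fset int} :=
  [fset a + b | a in A, b in B].

Definition diffset (A B : {fset int}) : {fset int} :=
  [fset a - b | a in A, b in B].

(* [k >= 1] summands give A + ... + A; the seed {0} only makes the case [k = 0]
   total.  [kfoldP] gives the elementwise description. *)
Definition kfold (k : nat) (A : {fset int}) : {fset int} :=
  iter k (sumset A) [fset 0].

Lemma kfoldP (k : nat) (A : {fset int}) (x : int) :
  x \in kfold k A <->
  exists2 f : 'I_k -> int, (forall i, f i \in A) & x = \sum_(i < k) f i.
Proof.
elim: k x => [|k IHk] x.
  rewrite /kfold /= inE; split => [/eqP ->|[f _ ->]].
    by exists (fun=> 0) => [[]|]//; rewrite big_ord0.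
  by rewrite big_ord0.
rewrite /kfold /= -/(kfold k A); split.
  case/imfset2P => a /= aA [b /= /IHk[f fA ->] ->].
  exists (fun i => if unlift ord0 i is Some j then f j else a) => [i|].
    by case: unliftP => [j _|_].
  rewrite big_ord_recl unlift_none; congr (_ + _).
  by apply: eq_bigr => i _; rewrite liftK.
case=> f fA ->; rewrite big_ord_recl.
apply/imfset2P; exists (f ord0); first exact: fA.
exists (\sum_(i < k) f (lift ord0 i)) => //=.
by apply/IHk; exists (fun i => f (lift ord0 i)).
Qed.

Definition diffs_cover (A : {fset int}) (q : nat) : Prop :=
  exists a : int,
    forall x : int, a + 1 <= x <= a + q%:Z -> x \in diffset A A.

Definition attained (k q : nat) : pred nat :=
  fun m => `[< exists2 A : {fset int}, diffs_cover A q & #|` kfold k A | = m >].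

Lemma attained_ex (k q : nat) : exists m, attained k q m.
Proof.
pose A : {fset int} := [fset i%:Z | i in iota 0 q.+1].
exists #|` kfold k A |; apply/asboolP; exists A => //.
exists 0 => x; rewrite !add0r => /andP[x1 xq].
apply/imfset2P; exists x.
  case: x x1 xq => // n _ nq; apply/imfsetP; exists n => //.
  by rewrite (mem_iota 0 q.+1 n) add0n ltnS.
exists 0; last by rewrite subr0.
by apply/imfsetP; exists 0%N.
Qed.

Definition G (k q : nat) : nat := ex_minn (attained_ex k q).

Definition alpha (R : realType) (k : nat) : R :=
  inf [set ln (G k q)%:R / ln q%:R | q in [set q : nat | (2 <= q)%N]].

(* [inf] is a junk value on sets that are empty or unbounded below. *)
Lemma alpha_has_inf (R : realType) (k : nat) :
  has_inf [set (ln (G k q)%:R / ln q%:R : R) | q in [set q : nat | (2 <= q)%N]].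
Proof.
split; first by exists (ln (G k 2)%:R / ln 2%:R); exists 2%N.
exists 0 => _ [q /= q2 <-]; apply: divr_ge0.
  case: (G k q) => [|n]; first by rewrite ln0.
  by rewrite ln_ge0 // ler1n.
by rewrite ln_ge0 // ler1n ltnW.
Qed.

(* Main.v *)
Require Import Defs.
From mathcomp Require Import all_boot all_order all_algebra.
From mathcomp Require Import all_classical all_reals all_analysis.
From mathcomp Require Import finmap zify ring lra.

Import Order.TTheory GRing.Theory Num.Theory.

Local Open Scope ring_scope.

(* Lower bound: [card_diffset_kfold] iterates Ruzsa's triangle inequality
   [|kA| |A - A| <= |(k+1)A|^2].

   Upper bound: it suffices to find [A] and [q] with [|kA| < q].  The set [A]
   consists of pairs [s x, s x + x] for [1 <= x <= q], so a [k]-fold sum has the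
   form [\sum_i (s (d i) + e i * d i)] with [e i] in {0, 1}.  By the Chinese
   remainder theorem [s] can be prescribed independently modulo finitely many
   primes; it is chosen so that each such sum is divisible by one of them.  Since
   the sum of the reciprocals of the primes can be made less than [1 / (2k + 1)],
   [kA] then has fewer than [q] elements, [q] being the product of the primes.

   To find the primes, fix [e] and a colouring of the integers, and consider the
   [d] with prescribed colours.  One prime [p] takes care of the [d] constant mod
   [p] on each colour class.  Any other [d] has two entries of the same colour
   separated by some residue class mod [p]; adding this class to the colouring
   gives finitely many finer colourings, handled by induction with far larger
   primes. *)

(** * Lower bound: Ruzsa's triangle inequality *)

Lemma diffset_repr (A : {fset int}) :
  exists y : int -> int,
    {in diffset A A, forall d, y d \in A /\ y d - d \in A}.
Proof.
suff /choice[y yP] : forall d, exists y, d \in diffset A A -> y \in A /\ y - d \in A.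
  by exists y.
move=> d; case: (boolP (d \in diffset A A)) => [|_]; last by exists 0.
case/imfset2P => a /= aA [b /= bA ->]; exists a => _; split=> //.
by rewrite subKr.
Qed.

(* Ruzsa's triangle inequality: with [d = y d - z d] a chosen representation,
   [(x, d) |-> (x + y d, x + z d)] is injective. *)
Lemma ruzsa_triangle (A X : {fset int}) :
  (#|` X| * #|` diffset A A| <= #|` sumset A X| ^ 2)%N.
Proof.
have [y yP] := diffset_repr A.
pose h (x d : int) := (y d + x, y d - d + x).
rewrite -mulnn -(size_allpairs h) -(size_allpairs pair).
apply: uniq_leq_size.
  apply: allpairs_uniq => [||[x d] [x' d'] _ _ /= [e1 e2]]; try exact: fset_uniq.
  have ed : d = d' by lia.
  by subst d'; congr pair; lia.
move=> _ /allpairsP[[x d] /= [xX /yP[yA zA] ->]].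
apply/allpairsP; exists (h x d); split => //=; apply/imfset2P.
- by exists (y d) => //; exists x.
- by exists (y d - d) => //; exists x.
Qed.

Lemma card_diffset_kfold (k : nat) (A : {fset int}) :
  (#|` diffset A A| ^ (2 ^ k - 1) <= #|` kfold k A| ^ (2 ^ k))%N.
Proof.
elim: k => [|k IHk]; first by rewrite expn0 /kfold /= cardfs1.
set D := #|` diffset A A| in IHk *.
(* This split pairs the induction hypothesis with the [2 ^ k]-th power of the triangle
   inequality. *)
have -> : (2 ^ k.+1 - 1 = (2 ^ k - 1) + 2 ^ k)%N by rewrite expnS; lia.
rewrite expnD expnS expnM; apply: leq_trans (leq_mul IHk (leqnn _)) _.
by rewrite -expnMn leq_exp2r ?expn_gt0 // (ruzsa_triangle A (kfold k A)).
Qed.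

Lemma diffs_cover_card (A : {fset int}) (q : nat) :
  diffs_cover A q -> (q <= #|` diffset A A|)%N.
Proof.
case=> a aP; rewrite -[q](size_iota 0) -(size_map (fun i => a + 1 + i%:Z)).
apply: uniq_leq_size; first by rewrite map_inj_uniq ?iota_uniq // => i j; lia.
by move=> _ /mapP[i + ->]; rewrite mem_iota => ?; apply: aP; lia.
Qed.

Lemma G_attained (k q : nat) :
  exists2 A : {fset int}, diffs_cover A q & #|` kfold k A| = G k q.
Proof. by rewrite /G; case: ex_minnP => m /asboolP. Qed.

Lemma G_le (k q : nat) (A : {fset int}) :
  diffs_cover A q -> (G k q <= #|` kfold k A|)%N.
Proof.
move=> AP; rewrite /G; case: ex_minnP => m _; apply.
by apply/asboolP; exists A.
Qed.

Lemma G_lower (k q : nat) : (q ^ (2 ^ k - 1) <= G k q ^ (2 ^ k))%N.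
Proof.
have [A /diffs_cover_card qD <-] := G_attained k q.
apply: leq_trans (card_diffset_kfold k A).
by case: (2 ^ k - 1)%N => [|n] //; rewrite leq_exp2r.
Qed.

Lemma log_ratio_lower (R : realType) (k q : nat) : (2 <= q)%N ->
  1 - 2 ^- k <= ln (G k q)%:R / ln q%:R :> R.
Proof.
move=> q2; have q0 : (0 < q)%N by exact: ltnW.
have lq : 0 < ln q%:R :> R by rewrite ln_gt0 // ltr1n.
have G0 : (0 < G k q)%N.
  case: posnP => // G0; have := G_lower k q.
  by rewrite G0 exp0n ?expn_gt0 // leqn0 expn_eq0 eqn0Ngt q0.
have : ln (q%:R ^+ (2 ^ k - 1)) <= ln ((G k q)%:R ^+ (2 ^ k)) :> R.
  by rewrite ler_ln ?posrE ?exprn_gt0 ?ltr0n // -!natrX ler_nat G_lower.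
rewrite !lnXn ?ltr0n // -[leLHS]mulr_natl -[leRHS]mulr_natl natrB ?expn_gt0 // natrX => h.
rewrite ler_pdivlMr // -(@ler_pM2l _ (2 ^+ k)) ?exprn_gt0 //.
by apply: le_trans h; rewrite mulrA mulrBr divff ?mulr1 // expf_neq0.
Qed.

(** * Covering endpoint sums by sparse sets of primes *)

Section Cover.

Variable k : nat.
Implicit Types (e : 'I_k -> bool) (d : 'I_k -> int).
Implicit Types (X : ('I_k -> bool) -> ('I_k -> int) -> Prop).

(** Here [f] stands for [s] modulo a single prime, and [e i] selects the endpoint [f x] or
    [f x + x]. *)
Definition endpoint_sum (f : int -> int) e d : int :=
  \sum_i (f (d i) + (if e i then d i else 0)).

(* The bounds [N] and [r] are at our disposal so that finite unions can be covered
   by disjoint sets of primes with small total density. *)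
Definition coverable X := forall (N : nat) (r : rat), 0 < r ->
  exists (P : seq nat) (f : nat -> int -> int),
    [/\ uniq P, {in P, forall p, prime p /\ (N < p)%N},
        \sum_(p <- P) p%:R^-1 < r &
        forall e d, X e d -> exists2 p : nat, p \in P & (p %| endpoint_sum (f p) e d)%Z].

Lemma coverable_sub X Y :
  (forall e d, X e d -> Y e d) -> coverable Y -> coverable X.
Proof.
move=> XY cY N r r0; have [P [f [uP pP sP fP]]] := cY N r r0.
by exists P, f; split => // e d /XY; apply: fP.
Qed.

Lemma coverable0 : coverable (fun _ _ => False).
Proof. by move=> N r r0; exists [::], (fun _ => id); split; rewrite ?big_nil. Qed.

Lemma coverableU X Y :
  coverable X -> coverable Y -> coverable (fun e d => X e d \/ Y e d).
Proof.
move=> cX cY N r r0; have r2 : 0 < r / 2 by rewrite divr_gt0.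
have [P [f [uP pP sP fP]]] := cX N _ r2.
(* The bound exceeds every element of [P], so [Q] is disjoint from [P] and each prime keeps a single
   function. *)
have [Q [h [uQ pQ sQ hQ]]] := cY (N + \sum_(p <- P) p)%N _ r2.
have dPQ p : p \in P -> p \in Q -> False.
  move=> pP' /pQ[_]; rewrite (big_rem p) //=; lia.
exists (P ++ Q), (fun p => if p \in P then f p else h p); split.
- rewrite cat_uniq uP uQ andbT /=; apply/hasPn => p pQ'.
  by apply/negP => /dPQ /(_ pQ').
- by move=> p; rewrite mem_cat => /orP[/pP|/pQ[? ?]] //; split => //; lia.
- by rewrite big_cat /=; lra.
- move=> e d [/fP|/hQ] [p pI pd]; exists p; rewrite ?mem_cat ?pI ?orbT //.
  by case: ifP => // /dPQ /(_ pI).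
Qed.

Lemma coverable_bigU (I : eqType) (s : seq I) (F : I -> _ -> _ -> Prop) :
  (forall i, i \in s -> coverable (F i)) ->
  coverable (fun e d => exists2 i, i \in s & F i e d).
Proof.
elim: s => [|i s IHs] cF; first by apply: coverable_sub coverable0 => e d [].
apply: (@coverable_sub _ (fun e d => F i e d \/ exists2 i, i \in s & F i e d)).
  move=> e d [j]; rewrite inE => /orP[/eqP ->|js Fj]; first by left.
  by right; exists j.
apply: coverableU; first by apply: cF; rewrite mem_head.
by apply: IHs => j js; apply: cF; rewrite inE js orbT.
Qed.

Definition fiber (g : 'I_k -> nat) (j : nat) : {set 'I_k} := [set i | g i == j].

(* If [d] is constant mod [p] on the fibers of its colouring [g], then a fiber of
   size [n] with [v] marked indices is cancelled mod [p] by [f x = - v x / n]. *)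
Lemma cancel_fibers (p : nat) (g : 'I_k -> nat) (c : int -> nat) e :
  prime p -> (k < p)%N ->
  exists f : int -> int, forall d, (forall i, c (d i) = g i) ->
    (forall i j, g i = g j -> (p %| d i - d j)%Z) -> (p %| endpoint_sum f e d)%Z.
Proof.
move=> pp kp.
have [r rP] : exists r : nat -> int, forall n, (0 < n < p)%N -> (p %| 1 - r n * n%:Z)%Z.
  suff /choice[r rP] : forall n, exists r : int, (0 < n < p)%N ->
    (p %| 1 - r * n%:Z)%Z by exists r.
  move=> n; case: (boolP (0 < n < p)%N) => [/andP[n0 np]|_]; last by exists 0.
  have /coprimezP[[u v] /= uv] : coprimez p n.
    by rewrite coprimezE /= prime_coprime // gtnNdvd.
  by exists v => _; rewrite -uv addrK dvdz_mull.
pose w j := r #|fiber g j|.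
exists (fun x => - (\sum_(i in fiber g (c x)) (e i)%:Z) * w (c x) * x) => d cd gd.
(* Exchanging the sums leaves, for each marked [i], the gap between [d i] and the mod [p] mean of
   [d] over its fiber. *)
have -> : endpoint_sum (fun x => - (\sum_(i in fiber g (c x)) (e i)%:Z) * w (c x) * x) e d =
    \sum_i (e i)%:Z * (d i - w (g i) * \sum_(j in fiber g (g i)) d j).
  rewrite /endpoint_sum big_split /= addrC.
  under [RHS]eq_bigr => i _ do rewrite mulrBr.
  rewrite [RHS]big_split /=; congr (_ + _).
    by apply: eq_bigr => i _; case: (e i); rewrite ?mul1r ?mul0r.
  transitivity (\sum_i \sum_(j in fiber g (g i)) - ((e j)%:Z * w (g i) * d i)).
    by apply: eq_bigr => i _; rewrite cd -sumrN !mulr_suml; apply: eq_bigr => j _; ring.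
  transitivity (\sum_i \sum_(j in fiber g (g i)) - ((e i)%:Z * w (g i) * d j)); last first.
    by apply: eq_bigr => i _; rewrite mulrA mulr_sumr sumrN.
  rewrite (exchange_big_dep xpredT) //=; apply: eq_bigr => i _.
  apply: eq_big => [j|j]; first by rewrite !inE eq_sym.
  by rewrite inE => /eqP ->.
apply: rpred_sum => i _; apply: dvdz_mull.
have -> : d i - w (g i) * (\sum_(j in fiber g (g i)) d j) =
   (1 - w (g i) * #|fiber g (g i)|%:Z) * d i
   + w (g i) * \sum_(j in fiber g (g i)) (d i - d j).
  by rewrite sumrB sumr_const -mulr_natr natz; ring.
apply: rpredD; apply/dvdzP/dvdzP.
  apply/dvdz_mulr/rP; apply/andP; split; first by apply/card_gt0P; exists i; rewrite inE.
  by apply: leq_ltn_trans kp; rewrite -[leqRHS]card_ord max_card.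
by apply/dvdz_mull/rpred_sum => j; rewrite inE => /eqP gj; apply: gd.
Qed.

(** Induction measure: refining [g] so as to separate two indices of equal colour strictly lowers
    it. *)
Definition coincidences (g : 'I_k -> nat) : nat := #|[set u : 'I_k * 'I_k | g u.1 == g u.2]|.

Lemma coverable_coloring (e0 : 'I_k -> bool) (g : 'I_k -> nat) (c : int -> nat) :
  coverable (fun e d => e = e0 /\ forall i, c (d i) = g i).
Proof.
have [n] := ubnP (coincidences g); elim: n g c => // n IHn g c gn N r r0.
(* Half of the density [r] goes to the prime [p], the other half to the finer colourings. *)
have [B Br] : exists B : nat, B.+1%:R^-1 < r / 2.
  exists (Num.truncn (r / 2)^-1).
  by rewrite invf_plt ?posrE ?ltr0n ?divr_gt0 // truncnS_gt.
have [p pN pp] := prime_above (N + k + B.+1)%N.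
have [f fP] := @cancel_fibers p g c e0 pp ltac:(lia).
(* The new colour has membership in the class of [x] mod [p] as its low bit; halving recovers the
   old colour. *)
pose g' (b : {ffun 'I_k -> bool}) i := (b i + (g i).*2)%N.
pose c' (x : nat) (y : int) := ((p %| (y - x%:Z)%R)%Z + (c y).*2)%N.
have : coverable (fun e d => exists2 u : nat * {ffun 'I_k -> bool},
    u \in [seq (x, b) | x <- iota 0 p, b <- [seq b <- enum {ffun 'I_k -> bool}
            | (coincidences (g' b) < n)%N]] &
    e = e0 /\ forall i, c' u.1 (d i) = g' u.2 i).
  apply: coverable_bigU => -[x b] /allpairsP[[x' b'] /= [_ + [-> ->]]].
  by rewrite mem_filter => /andP[? _]; apply: IHn.
case/(_ p (r / 2)); first lra.
move=> Q [h [uQ pQ sQ hQ]].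
have pnQ : p \notin Q by apply/negP => /pQ[_]; rewrite ltnn.
exists (p :: Q), (fun q => if q == p then f else h q); split.
- by rewrite /= pnQ.
- by move=> q; rewrite inE => /orP[/eqP ->|/pQ[? ?]]; split => //; lia.
- rewrite big_cons [r]splitr; apply: ltrD => //; apply: le_lt_trans Br.
  by rewrite lef_pV2 ?posrE ?ltr0n ?ler_nat //; lia.
move=> e d [ee0 cd]; subst e.
case: (pselect (forall i j, g i = g j -> (p %| d i - d j)%Z)) => [/(fP d cd)|].
  by exists p; rewrite ?mem_head // eqxx.
move=> /existsNP[i /existsNP[j /not_implyP[gij /negP dij]]].
(* The residue class of [d i] contains [d i] but not [d j], so the pair [(i, j)] stops being a
   coincidence. *)
pose x := `|(d i %% p)%Z|%N.
have xE : x%:Z = (d i %% p)%Z by rewrite gez0_abs // modz_ge0; lia.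
pose b := [ffun l => (p %| d l - x%:Z)%Z].
have [|q qQ qd] := hQ e0 d; last first.
- exists q; first by rewrite inE qQ orbT.
  by case: eqP => // qp; move: pnQ; rewrite -qp qQ.
exists (x, b); last first.
  by split=> // l; rewrite /c' /g' /= cd ffunE.
have di : (p %| d i - x%:Z)%Z by rewrite xE {1}(divz_eq (d i) p) addrK dvdz_mull.
apply/allpairsP; exists (x, b); split => //=.
  by rewrite mem_iota /= add0n -ltz_nat xE ltz_pmod //; lia.
rewrite mem_filter mem_enum andbT -ltnS; apply: leq_ltn_trans gn.
apply: proper_card; apply/properP; split.
  apply/fintype.subsetP => -[l m]; rewrite !inE => /eqP/(congr1 half).
  by rewrite !half_bit_double => ->.
exists (i, j); rewrite !inE /= ?gij // /g' gij eqn_add2r !ffunE di.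
have -> : (p %| d j - x%:Z)%Z = false; last by [].
apply/negP => dj; move/negP: dij; apply.
by rewrite (_ : d i - d j = (d i - x%:Z) - (d j - x%:Z)); [exact: rpredB | ring].
Qed.

Lemma coverableT : coverable (fun _ _ => True).
Proof.
apply: (@coverable_sub _ (fun e d => exists2 e0 : {ffun 'I_k -> bool},
   e0 \in enum {ffun 'I_k -> bool} & e = e0 /\ forall i, (fun=> 0%N) (d i) = 0%N)).
  move=> e d _; exists (finfun e); first by rewrite mem_enum.
  by split=> //; apply/funext => i; rewrite ffunE.
by apply: coverable_bigU => e0 _; exact: (@coverable_coloring e0 (fun=> 0%N) (fun=> 0%N)).
Qed.

End Cover.

(** * Upper bound: gluing the residues and counting *)

Lemma chinese_primes (P : seq nat) (a : nat -> int) :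
  uniq P -> {in P, forall p, prime p} ->
  exists x : int, {in P, forall p : nat, (p %| x - a p)%Z}.
Proof.
elim: P => [|p P IHP] /=; first by exists 0.
move=> /andP[pP uP] prP.
have [|x xP] := IHP uP; first by move=> q qP; apply: prP; rewrite inE qP orbT.
have cop : coprimez p (\prod_(q <- P) q)%N.
  rewrite coprimezE /= big_seq.
  apply: (big_ind (coprime p)) => [|m n cm cn|q qP]; first exact: coprimen1.
    by rewrite coprimeMr cm.
  rewrite prime_coprime ?dvdn_prime2 ?prP ?inE ?eqxx ?qP ?orbT //.
  by apply: contraNneq pP => ->.
exists (zchinese p (\prod_(q <- P) q)%N (a p) x) => q.
rewrite inE => /orP[/eqP ->|qP].
  by rewrite -eqz_mod_dvd; apply/eqP/zchinese_modl.
have qM : (q %| \prod_(q <- P) q)%N by rewrite (big_rem q) //= dvdn_mulr.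
rewrite -(subrK x (zchinese _ _ _ _)) -addrA rpredD //; last exact: xP.
apply: (@dvdz_trans (\prod_(q <- P) q)%N%:Z); first by rewrite dvdzE.
by rewrite -eqz_mod_dvd; apply/eqP/zchinese_modr.
Qed.

(** Union bound: each [p] dividing [L] has exactly [L / p] multiples in [[0, L)]. *)
Lemma card_multiples (P : seq nat) (L : nat) (S : {fset int}) :
  {in P, forall p, (0 < p)%N /\ (p %| L)%N} ->
  {in S, forall x, 0 <= x < L%:Z /\ exists2 p : nat, p \in P & (p %| x)%Z} ->
  #|` S|%:R <= L%:R * \sum_(p <- P) p%:R^-1 :> rat.
Proof.
move=> PL SP.
apply: (@le_trans _ _ (\sum_(p <- P) (L %/ p)%N)%:R); last first.
  rewrite natr_sum mulr_sumr !big_seq; apply: ler_sum => p /PL[p0 pL].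
  by rewrite -{2}(divnK pL) natrM mulfK ?pnatr_eq0 -?lt0n.
rewrite ler_nat.
apply: (@leq_trans (size (flatten [seq [seq (p * i)%:Z | i <- iota 0 (L %/ p)] | p <- P]))).
  apply: uniq_leq_size => [|x /SP[xL [p pP /dvdzP[y yx]]]]; first exact: fset_uniq.
  have [p0 pL] := PL p pP.
  apply/flatten_mapP; exists p => //; apply/mapP; exists `|y|%N; last by nia.
  rewrite mem_iota /= add0n ltn_divRL //; nia.
rewrite size_flatten /shape -map_comp sumnE big_map.
by apply/eq_leq/eq_bigr => p _ /=; rewrite size_map size_iota.
Qed.

Lemma exists_G_lt (k : nat) : exists2 q, (2 <= q)%N & (G k q < q)%N.
Proof.
(* Elements of [A] will lie in [[0, 2M]], hence [k]-fold sums in [[0, (2k + 1)M)]. *)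
have k2 : 0 < ((2 * k).+1%:R : rat)^-1 by rewrite invr_gt0 ltr0n.
have [P [f [uP pP sP fP]]] := @coverableT k 0%N _ k2.
pose M := (\prod_(p <- P) p)%N.
have PM p : p \in P -> (p %| M)%N by move=> pIP; rewrite /M (big_rem p) //= dvdn_mulr.
have M0 : (0 < M)%N by rewrite /M big_seq prodn_cond_gt0 // => p /pP[/prime_gt0].
have /choice[Phi PhiP] : forall x, exists y,
    {in P, forall p : nat, (p %| y - f p x)%Z}.
  by move=> x; apply: chinese_primes => // p /pP[].
pose s x := (Phi x %% M)%Z.
have sM x : 0 <= s x < M%:Z by rewrite modz_ge0 ?ltz_pmod //; lia.
pose A : {fset int} :=
  [fset (s i%:Z + (if b then i%:Z else 0))%R | i in iota 1 M, b in [:: true; false]]%fset.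
(* Covering any one pair [e], [d] already forces [P] to be nonempty. *)
have M2 : (2 <= M)%N.
  have [p pIP _] := fP (fun=> true) (fun=> 0) I.
  by have [/prime_gt1 p1 _] := pP p pIP; apply: leq_trans p1 _; apply: dvdn_leq (PM p pIP).
exists M => //; apply: leq_ltn_trans (_ : #|` kfold k A| < M)%N.
  apply: G_le; exists 0 => x xM; apply/imfset2P.
  have ix : `|x|%N \in iota 1 M by rewrite mem_iota; lia.
  have xE : `|x|%N%:Z = x by lia.
  exists (s x + x); first by apply/imfset2P; exists `|x|%N => //; exists true; rewrite ?inE ?xE.
  exists (s x); last by rewrite addrC addKr.
  by apply/imfset2P; exists `|x|%N => //; exists false; rewrite ?inE ?xE ?addr0.
rewrite -(ltr_nat rat).
apply: (@le_lt_trans _ _ (((2 * k).+1 * M)%:R * \sum_(p <- P) p%:R^-1)); last first.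
  by rewrite natrM mulrAC -[ltRHS]mul1r ltr_pM2r ?ltr0n // -ltr_pdivlMl ?ltr0n // mulr1.
apply: card_multiples => [p pIP|x /kfoldP[a aA ->]].
  by split; [case/pP: pIP => /prime_gt0 | rewrite dvdn_mull // PM].
have /choice[u uE] : forall i, exists u : bool * nat,
    (u.2 <= M)%N /\ a i = s u.2%:Z + (if u.1 then u.2%:Z else 0).
  move=> i; have /imfset2P[n /= nM [b /= _ ->]] := aA i.
  by move: nM; rewrite mem_iota add1n ltnS => /andP[_ nM]; exists (b, n).
have aM i : 0 <= a i <= (2 * M)%N%:Z.
  by have [+ ->] := uE i; have := sM (u i).2; case: (u i).1; lia.
split.
  rewrite sumr_ge0 => [|i _] /=; last by case/andP: (aM i).
  apply: (@le_lt_trans _ _ (\sum_(i < k) (2 * M)%N%:Z)).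
    by apply: ler_sum => i _; case/andP: (aM i).
  by rewrite sumr_const card_ord -mulr_natr natz; nia.
have [p pIP pd] := fP (fun i => (u i).1) (fun i => (u i).2%:Z) I.
exists p => //.
(* Modulo [p], which divides [M], [s] agrees with [Phi] and so with [f p]; the sum is thus congruent
   to [t]. *)
pose t := endpoint_sum k (f p) (fun i => (u i).1) (fun i => (u i).2%:Z).
rewrite -[X in (_ %| X)%Z](subrK t).
apply: rpredD => //; rewrite /t /endpoint_sum -sumrB; apply: rpred_sum => i _.
have [_ ->] := uE i; rewrite opprD addrACA subrr addr0.
rewrite -(subrK (Phi (u i).2%:Z) (s _)) -addrA rpredD //; last exact: PhiP.
apply: (@dvdz_trans M%:Z); first by rewrite dvdzE PM.
by rewrite -eqz_mod_dvd /s modz_mod.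
Qed.

Theorem theorem2 (R : realType) (k : nat) (hk : (0 < k)%N) :
  1 - 2 ^- k <= alpha R k /\ alpha R k < 1.
Proof.
have [ne lb] := alpha_has_inf R k; split.
  by apply: lb_le_inf => // _ [q /= q2 <-]; apply: log_ratio_lower.
have [q q2 Gq] := exists_G_lt k.
apply: (@le_lt_trans _ _ (ln (G k q)%:R / ln q%:R)); first by apply: ge_inf => //; exists q.
have lq : 0 < ln q%:R :> R by rewrite ln_gt0 // ltr1n.
rewrite ltr_pdivrMr // mul1r.
(* By convention [ln 0] is [0], still below [ln q]. *)
case: (posnP (G k q)) => [->|G0]; first by rewrite ln0.
by rewrite ltr_ln ?posrE ?ltr0n ?ltr_nat //; lia.
Qed.
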